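(* Let $p\in(1,2]$ and let $\varphi:\mathbb{R}^n\to\mathbb{R}\cup\{+\infty\}$ be proper and lower semicontinuous. Suppose $\bar x=0$ is a $p$-calm point of $\varphi$ with constant $M>0$, $\varphi(0)=0$, and $\varphi$ is $q$-prox-regular with some $q\ge2$ at $\bar x=0$ for $\bar\zeta=0\in\partial\varphi(0)$ with constants $\varepsilon>0$ and $\rho>0$. Then for each $\gamma\in\big(0,\frac{2^{1-p}}{Mp}\big)$ when $p\in(1,2)$, and each $\gamma\in\big(0,\min\{\frac1{4M},\frac1\rho\}\big)$ when $p=2$, there exists a neighbourhood $U$ of $0$ such that $\operatorname{prox}^p_{\gamma\varphi}$ is single-valued and continuous on $U$ and $\varphi^p_\gamma\in C^1(U)$.
   Context: $\operatorname{prox}^p_{\gamma\varphi}(x):=\operatorname{argmin}_{y}\big(\varphi(y)+\frac{1}{p\gamma}\|x-y\|^p\big)$, $\varphi^p_\gamma(x):=\inf_y\big(\varphi(y)+\frac{1}{p\gamma}\|x-y\|^p\big)$. $\bar x$ is a $p$-calm point with constant $M>0$ if $\varphi(x)+M\|x-\bar x\|^p>\varphi(\bar x)$ for all $x\neq\bar x$. $\partial$ denotes the Mordukhovich (limiting) subdifferential. $\varphi$ is $q$-prox-regular ($q\ge2$) at $\bar x\in\operatorname{dom}\varphi$ for $\bar\zeta\in\partial\varphi(\bar x)$ with constants $\varepsilon>0,\rho\ge0$ if $\varphi(x')\ge\varphi(x)+\langle\zeta,x'-x\rangle-\frac\rho2\|x'-x\|^q$ for all $x'\in\mathbb{B}(\bar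 x;\varepsilon)$, whenever $x\in\mathbb{B}(\bar x;\varepsilon)$, $\zeta\in\partial\varphi(x)\cap\mathbb{B}(\bar\zeta;\varepsilon)$ and $\varphi(x)<\varphi(\bar x)+\varepsilon$. *)

(* Defs.v *)
From HB Require Import structures.
From mathcomp Require Import all_boot all_order all_algebra.
From mathcomp Require Import all_classical all_reals all_analysis.
Set Implicit Arguments. Unset Strict Implicit. Unset Printing Implicit Defensive.
Import Order.TTheory GRing.Theory Num.Theory.
Import numFieldNormedType.Exports.
Local Open Scope classical_set_scope.
Local Open Scope ring_scope.

Section Defs.
Context {R : realType} {n : nat}.
Implicit Types (x y v : 'rV[R]_n) (phi : 'rV[R]_n -> \bar R).

Definition dotp x y : R := \sum_(i < n) x ord0 i * y ord0 i.
Definition enorm x : R := Num.sqrt (dotp x x).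
Definition eball (c : 'rV[R]_n) (r : R) : set 'rV[R]_n :=
  [set x | enorm (x - c) <= r].

Definition proper_fun phi : Prop :=
  (forall x, phi x != -oo%E) /\ (exists x, phi x != +oo%E).

Definition p_calm phi (p M : R) (xb : 'rV[R]_n) : Prop :=
  forall x, x != xb -> (phi xb < phi x + ((enorm (x - xb)) `^ p * M)%:E)%E.

Definition frechet_subdiff phi x : set 'rV[R]_n :=
  [set v | phi x \is a fin_num /\
    forall e : R, 0 < e -> exists2 d : R, 0 < d & forall y, enorm (y - x) < d ->
      (phi x + (dotp v (y - x) - e * enorm (y - x))%:E <= phi y)%E].

Definition limiting_subdiff phi x : set 'rV[R]_n :=
  [set v | phi x \is a fin_num /\
    exists (xk vk : nat -> 'rV[R]_n),
      [/\ xk @ \oo --> x, (fun k => phi (xk k)) @ \oo --> phi x,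
          vk @ \oo --> v & forall k, frechet_subdiff phi (xk k) (vk k)]].

Definition q_prox_regular phi (q : R) (xb zb : 'rV[R]_n) (eps rho : R) : Prop :=
  limiting_subdiff phi xb zb /\
  forall x zeta, eball xb eps x -> limiting_subdiff phi x zeta ->
    eball zb eps zeta -> (phi x < phi xb + eps%:E)%E ->
    forall x', eball xb eps x' ->
      (phi x + (dotp zeta (x' - x) - rho / 2 * (enorm (x' - x)) `^ q)%:E
         <= phi x')%E.

Definition prox_obj phi (p gamma : R) x y : \bar R :=
  (phi y + ((enorm (x - y)) `^ p / (p * gamma))%:E)%E.

Definition moreau_env phi (p gamma : R) x : \bar R :=
  ereal_inf [set prox_obj phi p gamma x y | y in [set: 'rV[R]_n]].

Definition prox phi (p gamma : R) x : set 'rV[R]_n :=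
  [set y | forall z, (prox_obj phi p gamma x y <= prox_obj phi p gamma x z)%E].

End Defs.

(* Main.v *)
(** Write [u = x - y] and [J u = |u|^(p-2) u / gamma], the gradient of the
    penalty [|u|^p / (p gamma)].  Calmness makes [y |-> phi y + penalty (x - y)]
    coercive, and forces every minimiser [y] to satisfy [|x - y| <= K |x|].  At
    a minimiser [J (x - y)] is a subgradient of [phi], so for small [x]
    prox-regularity applies at [y]; since the penalty is strongly convex on
    small balls with a modulus larger than [rho], the objective grows
    quadratically around [y].  Comparing this growth for two centres [x], [x']
    gives [|y' - y|^2 <= C |x' - x|], hence uniqueness and continuity at once.
    Convexity of the penalty sandwiches the increment of the envelope,
      [<J (x - y'), x' - x> <= e x' - e x <= <J (x' - y), x' - x>],
    and continuity of [J] turns this into differentiability with gradient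
    [J (x - y)]. *)
Require Import Defs.
From HB Require Import structures.
From mathcomp Require Import all_boot all_order all_algebra.
From mathcomp Require Import all_classical all_reals all_analysis.
From mathcomp Require Import ring lra.
Import Order.TTheory GRing.Theory Num.Theory.
Import numFieldNormedType.Exports.
Local Open Scope classical_set_scope.
Local Open Scope ring_scope.
Set Implicit Arguments. Unset Strict Implicit. Unset Printing Implicit Defensive.

(** * Euclidean geometry on row vectors *)

Lemma dotpC (R : realType) (n : nat) (x y : 'rV[R]_n) : dotp x y = dotp y x.
Proof. by apply: eq_bigr => i _; rewrite mulrC. Qed.

Lemma dotpDl (R : realType) (n : nat) (x y z : 'rV[R]_n) :
  dotp (x + y) z = dotp x z + dotp y z.
Proof.
by rewrite /dotp -big_split; apply: eq_bigr => i _; rewrite !mxE mulrDl.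
Qed.

Lemma dotpZl (R : realType) (n : nat) (a : R) (x z : 'rV[R]_n) :
  dotp (a *: x) z = a * dotp x z.
Proof. by rewrite /dotp mulr_sumr; apply: eq_bigr => i _; rewrite !mxE mulrA. Qed.

Lemma dotpNl (R : realType) (n : nat) (x z : 'rV[R]_n) :
  dotp (- x) z = - dotp x z.
Proof. by rewrite -scaleN1r dotpZl mulN1r. Qed.

Lemma dotpDr (R : realType) (n : nat) (x y z : 'rV[R]_n) :
  dotp z (x + y) = dotp z x + dotp z y.
Proof. by rewrite !(dotpC z) dotpDl. Qed.

Lemma dotpZr (R : realType) (n : nat) (a : R) (x z : 'rV[R]_n) :
  dotp z (a *: x) = a * dotp z x.
Proof. by rewrite !(dotpC z) dotpZl. Qed.

Lemma dotpNr (R : realType) (n : nat) (x z : 'rV[R]_n) :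
  dotp z (- x) = - dotp z x.
Proof. by rewrite !(dotpC z) dotpNl. Qed.

Lemma dotp_ge0 (R : realType) (n : nat) (x : 'rV[R]_n) : 0 <= dotp x x.
Proof. by apply: sumr_ge0 => i _; rewrite -expr2 sqr_ge0. Qed.

Lemma enorm_ge0 (R : realType) (n : nat) (x : 'rV[R]_n) : 0 <= enorm x.
Proof. exact: sqrtr_ge0. Qed.

Lemma sqr_enorm (R : realType) (n : nat) (x : 'rV[R]_n) :
  enorm x ^+ 2 = dotp x x.
Proof. by rewrite sqr_sqrtr ?dotp_ge0. Qed.

Lemma enorm0_eq0 (R : realType) (n : nat) (x : 'rV[R]_n) :
  enorm x = 0 -> x = 0.
Proof.
move=> /(congr1 (fun t => t ^+ 2)); rewrite sqr_enorm expr0n /= => /eqP.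
rewrite psumr_eq0 => [/allP x0|i _]; last by rewrite -expr2 sqr_ge0.
apply/rowP => i; rewrite mxE; apply/eqP.
by rewrite -[_ == _]orbb -mulf_eq0; apply: x0; rewrite mem_index_enum.
Qed.

Lemma enorm0 (R : realType) (n : nat) : enorm (0 : 'rV[R]_n) = 0.
Proof. by rewrite /enorm /dotp big1 ?sqrtr0// => i _; rewrite mxE mul0r. Qed.

Lemma enormN (R : realType) (n : nat) (x : 'rV[R]_n) : enorm (- x) = enorm x.
Proof. by rewrite /enorm dotpNl dotpNr opprK. Qed.

Lemma enormB (R : realType) (n : nat) (x y : 'rV[R]_n) :
  enorm (x - y) = enorm (y - x).
Proof. by rewrite -enormN opprB. Qed.

Lemma enormZ (R : realType) (n : nat) (a : R) (x : 'rV[R]_n) :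
  enorm (a *: x) = `|a| * enorm x.
Proof.
by rewrite /enorm dotpZl dotpZr mulrA -expr2 sqrtrM ?sqr_ge0// sqrtr_sqr.
Qed.

(** Cauchy-Schwarz, from expanding the nonnegative square of [|y|^2 x - <x, y> y]. *)
Lemma dotp_le (R : realType) (n : nat) (x y : 'rV[R]_n) :
  dotp x y <= enorm x * enorm y.
Proof.
have [y0|yN0] := eqVneq (enorm y) 0.
  by rewrite y0 mulr0 (enorm0_eq0 y0) -(scale0r 0) dotpZr mul0r.
have y_gt0 : 0 < enorm y by rewrite lt_def yN0 enorm_ge0.
have := dotp_ge0 (enorm y ^+ 2 *: x - dotp x y *: y).
rewrite !(dotpDl, dotpDr, dotpNl, dotpNr, dotpZl, dotpZr) (dotpC y x).
rewrite -!sqr_enorm => H.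
have : 0 <= enorm y ^+ 2 * ((enorm x * enorm y) ^+ 2 - dotp x y ^+ 2) by nra.
rewrite pmulr_rge0 ?exprn_gt0// subr_ge0 => {}H.
rewrite (le_trans (ler_norm _))// -(@ler_pXn2r _ 2) ?nnegrE ?mulr_ge0 ?enorm_ge0//.
by rewrite real_normK// num_real.
Qed.

Lemma dotp_ge (R : realType) (n : nat) (x y : 'rV[R]_n) :
  - (enorm x * enorm y) <= dotp x y.
Proof. by rewrite lerNl -dotpNl (le_trans (dotp_le _ _))// enormN. Qed.

Lemma enorm_triangle (R : realType) (n : nat) (x y : 'rV[R]_n) :
  enorm (x + y) <= enorm x + enorm y.
Proof.
rewrite -(@ler_pXn2r _ 2) ?nnegrE ?addr_ge0 ?enorm_ge0//.
rewrite sqr_enorm dotpDl !dotpDr (dotpC y x) -!sqr_enorm.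
by have := dotp_le x y; nra.
Qed.

Lemma coord_le_enorm (R : realType) (n : nat) (x : 'rV[R]_n) (j : 'I_n) :
  `|x ord0 j| <= enorm x.
Proof.
rewrite -(@ler_pXn2r _ 2) ?nnegrE ?enorm_ge0// real_normK ?num_real//.
rewrite sqr_enorm /dotp (bigD1 j)//= -expr2 lerDl sumr_ge0// => k _.
by rewrite -expr2 sqr_ge0.
Qed.

Lemma norm_le_enorm (R : realType) (n : nat) (x : 'rV[R]_n) : `|x| <= enorm x.
Proof.
rewrite [leLHS]/Num.norm /= mx_normrE; apply/bigmax_leP; split.
  exact: enorm_ge0.
by move=> [i j] _ /=; rewrite ord1; exact: coord_le_enorm.
Qed.

(** With [norm_le_enorm], this transfers Euclidean estimates to the topology, which comes from the
    sup norm. The crude factor [n.+1] stays positive when [n = 0]. *)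
Lemma enorm_le_norm (R : realType) (n : nat) (x : 'rV[R]_n) :
  enorm x <= n.+1%:R * `|x|.
Proof.
rewrite -(@ler_pXn2r _ 2) ?nnegrE ?enorm_ge0 ?mulr_ge0//.
rewrite sqr_enorm (@le_trans _ _ (\sum_(i < n) `|x| ^+ 2))//.
  apply: ler_sum => i _; rewrite -expr2 -real_normK ?num_real//.
  rewrite ler_pXn2r ?nnegrE//.
  rewrite [leRHS]/Num.norm /= mx_normrE.
  by apply/bigmax_geP; right => /=; exists (ord0, i).
rewrite sumr_const card_ord exprMn -[leLHS]mulr_natl ler_wpM2r ?sqr_ge0//.
by rewrite -natrX ler_nat (leq_trans (leqnSn n))// leq_pmulr.
Qed.

Lemma nbhs_enorm (R : realType) (n : nat) (x : 'rV[R]_n) (e : R) : 0 < e ->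
  nbhs x [set y | enorm (y - x) < e].
Proof.
move=> e0; have n0 : 0 < n.+1%:R :> R by rewrite ltr0n.
apply: (iffRL (nbhs_normP x (fun y => enorm (y - x) < e))).
exists (e / n.+1%:R) => /=; first by rewrite divr_gt0.
move=> y /=; rewrite distrC ltr_pdivlMr// mulrC.
exact/le_lt_trans/enorm_le_norm.
Qed.

(** * Powers of nonnegative reals *)

Lemma powR_small (R : realType) (a e : R) : 0 < a -> 0 < e ->
  exists2 d : R, 0 < d & forall t, 0 <= t -> t <= d -> t `^ a <= e.
Proof.
move=> a0 e0; exists (e `^ a^-1) => [|t t0 td]; first exact: powR_gt0.
rewrite -[leRHS](powRr1 (ltW e0)) -(mulVf (lt0r_neq0 a0)) powRrM.
by apply: ge0_ler_powR; rewrite ?nnegrE ?powR_ge0 ?(ltW a0).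
Qed.

Lemma powR_MVT (R : realType) (p s t : R) : 0 < s -> s < t ->
  exists c, [/\ s < c, c < t & t `^ p - s `^ p = p * c `^ (p - 1) * (t - s)].
Proof.
move=> s0 st; have dp (x : R) : s <= x ->
    is_derive x 1 (fun z : R => z `^ p) (p * x `^ (p - 1)).
  by move=> sx; apply: is_derive1_powR; exact: lt_le_trans sx.
have [x||c] := @MVT _ (fun z : R => z `^ p) (fun x => p * x `^ (p - 1)) _ _ st.
- by rewrite in_itv /= => /andP[/ltW + _]; apply: dp.
- apply: derivable_within_continuous => x; rewrite in_itv /= => /andP[sx _].
  by have [] := dp x sx.
- by rewrite in_itv /= => /andP[sc ct] ->; exists c.
Qed.

Lemma le0_ger_powR (R : realType) (a s t : R) : a <= 0 -> 0 < s -> s <= t ->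
  t `^ a <= s `^ a.
Proof.
move=> a0 s0 st; rewrite -(opprK a) !(powRN _ (- a)).
have t0 := lt_le_trans s0 st.
rewrite lef_pV2 ?posrE ?powR_gt0//.
by apply: ge0_ler_powR; rewrite ?nnegrE ?oppr_ge0// ltW.
Qed.

Lemma powR_sub_ge (R : realType) (p r s t : R) : 1 < p -> p <= 2 ->
  0 < s -> s <= t -> t <= r ->
  (p - 1) * r `^ (p - 2) * (t - s) <= t `^ (p - 1) - s `^ (p - 1).
Proof.
move=> p1 p2 s0; rewrite le_eqVlt => /predU1P[->|st] tr.
  by rewrite !subrr mulr0.
have [c [sc ct ->]] := powR_MVT (p - 1) s0 st.
rewrite ler_wpM2r ?subr_ge0 ?(ltW st)// ler_wpM2l ?subr_ge0 ?(ltW p1)//.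
have -> : p - 1 - 1 = p - 2 by ring.
by apply: le0_ger_powR; lra.
Qed.

(** The second derivative [(p - 1) t^(p - 2)] of [t^p / p] is nonincreasing, so on []0, r]] its
    value at [r] is a modulus of strong convexity. The derivative argument needs positive points;
    [a = 0] and [b = 0] are treated algebraically. *)
Lemma powR_strongly_convex (R : realType) (p r a b : R) : 1 < p -> p <= 2 ->
  0 <= a -> a <= r -> 0 <= b -> b <= r ->
  a `^ p / p + a `^ (p - 1) * (b - a)
    + (p - 1) * r `^ (p - 2) / 2 * (b - a) ^+ 2 <= b `^ p / p.
Proof.
move=> p1 p2; have p0 : 0 < p by lra.
have pm1 : 0 < p - 1 by lra.
set k := (p - 1) * r `^ (p - 2).
have kp c : 0 < c -> c <= r -> k * c ^+ 2 <= (p - 1) * c `^ p.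
  move=> c0 cr; rewrite /k -mulrA ler_wpM2l ?(ltW pm1)//.
  have -> : c `^ p = c `^ (p - 2) * c ^+ 2.
    rewrite -powR_mulrn ?(ltW c0)// -powRD; first by congr (_ `^ _); ring.
    by rewrite (gt_eqF c0) implybT.
  by rewrite ler_wpM2r ?sqr_ge0// le0_ger_powR//; lra.
rewrite le_eqVlt => /predU1P[<- _|a0 ar].
  rewrite le_eqVlt => /predU1P[<- _|b0 br].
    by rewrite subrr expr0n/= !mulr0 !addr0.
  rewrite !powR0 ?(gt_eqF p0) ?(gt_eqF pm1)// !mul0r !add0r subr0.
  rewrite ler_pdivlMr//; have B0 := powR_gt0 p b0.
  have H1 : p * (k * b ^+ 2) <= p * ((p - 1) * b `^ p).
    by rewrite ler_pM2l//; exact: kp.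
  (* After [H1] it remains to see [p (p - 1) <= 2], which is [(2 - p) (p + 1) >= 0]. *)
  have H2 : 0 <= b `^ p * ((2 - p) * (p + 1)).
    by rewrite !mulr_ge0 ?(ltW B0)//; lra.
  by lra.
rewrite le_eqVlt => /predU1P[<- _|b0 br].
  rewrite sub0r mulrN (mulrC _ a) mulr_powRB1 ?(ltW a0)// sqrrN powR0 ?(gt_eqF p0)//.
  rewrite mul0r; have := kp a a0 ar; have := powR_gt0 p a0 => A0 H.
  have : a `^ p / p - a `^ p + (p - 1) / 2 * a `^ p <= 0; last by lra.
  have -> : a `^ p / p - a `^ p + (p - 1) / 2 * a `^ p =
    a `^ p * (p - 1) * (p - 2) / (2 * p) by field; rewrite gt_eqF.
  rewrite pmulr_lle0 ?invr_gt0; last by lra.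
  by rewrite pmulr_rle0 ?mulr_gt0//; lra.
(* Up to a constant, [psi] is [z^p / p] minus its tangent at [a] and minus [k / 2 (z - a)^2]. Its
   derivative [dpsi] has the sign of [z - a] by [powR_sub_ge], so [a] minimises it. *)
pose psi z := p^-1 * z `^ p - (a `^ (p - 1) - k * a) * z - k / 2 * (z * z).
pose dpsi z := z `^ (p - 1) - a `^ (p - 1) - k * (z - a).
have dpsiE (z : R) : 0 < z -> is_derive z 1 psi (dpsi z).
  move=> z0; rewrite /psi /dpsi.
  have := is_derive1_powR p z0 => dz.
  apply: is_derive_eq; rewrite /GRing.scale /=.
  by field; rewrite gt_eqF.
have MVTpsi s t : 0 < s -> s < t ->
    exists c, [/\ s < c, c < t & psi t - psi s = dpsi c * (t - s)].
  move=> s0 st.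
  have ds (z : R) : s <= z -> is_derive z 1 psi (dpsi z).
    by move=> sz; apply: dpsiE; exact: lt_le_trans sz.
  have [x||c] := @MVT _ psi dpsi _ _ st.
  - by rewrite in_itv /= => /andP[/ltW + _]; apply: ds.
  - apply: derivable_within_continuous => x; rewrite in_itv /= => /andP[sx _].
    by have [] := ds x sx.
  - by rewrite in_itv /= => /andP[sc ct] ->; exists c.
suff H : 0 <= psi b - psi a.
  rewrite -subr_ge0 [leRHS](_ : _ = psi b - psi a)// /psi; field.
  by rewrite gt_eqF.
have [ab|ba|->] := ltgtP a b; last by rewrite subrr.
  have [c [ac cb ->]] := MVTpsi a b a0 ab.
  rewrite mulr_ge0 ?subr_ge0 ?(ltW ab)// powR_sub_ge//; lra.
have [c [bc ca H]] := MVTpsi b a b0 ba.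
rewrite -opprB H -mulNr mulr_ge0 ?subr_ge0 ?(ltW ba)//.
have := @powR_sub_ge _ p r c a p1 p2 (lt_trans b0 bc) (ltW ca) ar.
by rewrite -/k /dpsi; lra.
Qed.

(** * The power penalty and its gradient *)

Definition penalty (R : realType) (n : nat) (p gamma : R) (u : 'rV[R]_n) : R :=
  enorm u `^ p / (p * gamma).

(* At [u = 0] the factor [0 `^ (p - 2)] is [0] or [1]; either way this is [0]. *)
Definition dpenalty (R : realType) (n : nat) (p gamma : R) (u : 'rV[R]_n) :
  'rV[R]_n := (enorm u `^ (p - 2) / gamma) *: u.

Lemma penalty_ge0 (R : realType) (n : nat) (p gamma : R) (u : 'rV[R]_n) :
  0 < p -> 0 < gamma -> 0 <= penalty p gamma u.
Proof. by move=> p0 g0; rewrite divr_ge0 ?powR_ge0// mulr_ge0 ?ltW. Qed.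

(** The scalar inequality for [a = |u|] and [b = |v|] settles the case [<u, v> = a b]. In general
    the two sides differ further by [(a^(p-2) - k) (a b - <u, v>)], nonnegative by Cauchy-Schwarz
    and [k <= r^(p-2) <= a^(p-2)]. *)
Lemma penalty_strongly_convex (R : realType) (n : nat) (p gamma r : R)
    (u v : 'rV[R]_n) : 1 < p -> p <= 2 -> 0 < gamma ->
  enorm u <= r -> enorm v <= r ->
  penalty p gamma u + dotp (dpenalty p gamma u) (v - u)
    + (p - 1) * r `^ (p - 2) / gamma / 2 * enorm (v - u) ^+ 2
  <= penalty p gamma v.
Proof.
move=> p1 p2 g0 ur vr.
set k := (p - 1) * r `^ (p - 2); set a := enorm u; set b := enorm v.
have k0 : 0 <= k by rewrite mulr_ge0 ?powR_ge0//; lra.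
have /= := powR_strongly_convex p1 p2 (enorm_ge0 u) ur (enorm_ge0 v) vr.
rewrite -/a -/b -/k => H.
have sab : dotp u v <= a * b := dotp_le u v.
have dE : enorm (v - u) ^+ 2 = a ^+ 2 + b ^+ 2 - 2 * dotp u v.
  rewrite sqr_enorm !(dotpDl, dotpDr, dotpNl, dotpNr) (dotpC v u).
  by rewrite -!sqr_enorm -/a -/b; ring.
have pm2 : p - 2 <= 0 by rewrite subr_le0.
have pN0 : p != 0 by rewrite gt_eqF// (lt_trans _ p1).
have pm1N0 : p - 1 != 0 by rewrite gt_eqF// subr_gt0.
have key : a `^ (p - 2) * (dotp u v - a ^+ 2) + k / 2 * enorm (v - u) ^+ 2 <=
    a `^ (p - 1) * (b - a) + k / 2 * (b - a) ^+ 2.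
  have [a0|aN0] := eqVneq a 0.
    have u0 : u = 0 by apply: enorm0_eq0.
    have s0 : dotp u v = 0 by rewrite u0 -(scale0r 0) dotpZl mul0r.
    rewrite dE s0 a0 (powR0 pm1N0).
    by rewrite expr0n /= !(mulr0, mul0r, subr0, add0r).
  have a0 : 0 < a by rewrite lt_def aN0 enorm_ge0.
  have -> : a `^ (p - 1) = a `^ (p - 2) * a.
    rewrite -[X in _ * X](powRr1 (ltW a0)) -powRD; last by rewrite aN0 implybT.
    by congr (_ `^ _); ring.
  have ka : k <= a `^ (p - 2).
    have ra : r `^ (p - 2) <= a `^ (p - 2) by exact: le0_ger_powR.
    by apply: le_trans ra; rewrite /k ler_piMl ?powR_ge0// lerBlDr.
  have : 0 <= (a `^ (p - 2) - k) * (a * b - dotp u v).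
    by rewrite mulr_ge0// subr_ge0.
  by rewrite dE; lra.
have -> : dotp (dpenalty p gamma u) (v - u) =
    a `^ (p - 2) * (dotp u v - a ^+ 2) / gamma.
  by rewrite dotpZl dotpDr dotpNr -sqr_enorm -/a; ring.
have -> : penalty p gamma u = a `^ p / p / gamma.
  by rewrite /penalty -/a; field; rewrite gt_eqF.
have -> : penalty p gamma v = b `^ p / p / gamma.
  by rewrite /penalty -/b; field; rewrite gt_eqF.
have -> : k / gamma / 2 * enorm (v - u) ^+ 2 = k / 2 * enorm (v - u) ^+ 2 / gamma.
  by ring.
rewrite -!mulrDl ler_pM2r ?invr_gt0//.
by apply: le_trans H; rewrite -!addrA lerD2l.
Qed.

Lemma penalty_convex (R : realType) (n : nat) (p gamma : R) (u v : 'rV[R]_n) :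
  1 < p -> p <= 2 -> 0 < gamma ->
  penalty p gamma u + dotp (dpenalty p gamma u) (v - u) <= penalty p gamma v.
Proof.
move=> p1 p2 g0.
have := @penalty_strongly_convex _ _ p gamma (enorm u + enorm v) u v p1 p2 g0.
rewrite lerDl enorm_ge0 lerDr enorm_ge0 => /(_ isT isT); apply: le_trans.
rewrite lerDl !mulr_ge0 ?enorm_ge0 ?invr_ge0 ?powR_ge0 ?(ltW g0)//.
by rewrite subr_ge0 ltW.
Qed.

Lemma enorm_dpenalty (R : realType) (n : nat) (p gamma : R) (u : 'rV[R]_n) :
  1 < p -> 0 < gamma ->
  enorm (dpenalty p gamma u) = enorm u `^ (p - 1) / gamma.
Proof.
move=> p1 g0; rewrite enormZ ger0_norm ?divr_ge0 ?powR_ge0 ?(ltW g0)//.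
have [->|u0] := eqVneq (enorm u) 0.
  by rewrite mulr0 powR0 ?mul0r// gt_eqF// subr_gt0.
rewrite mulrAC -[X in _ * X / _](powRr1 (enorm_ge0 u)) -powRD ?u0 ?implybT//.
by congr (_ `^ _ / _); ring.
Qed.

(** With [a = |u| >= b = |v|] and [d = |u - v|], split the difference, up to [1 / gamma], into
    [a^(p-2) (u - v)] and [(a^(p-2) - b^(p-2)) v]. Each has norm at most [a^(p-2) d]: for the
    second, [b^(p-1) <= a^(p-1)] and [a - b <= d]. *)
Lemma dpenalty_hoelder (R : realType) (n : nat) (p gamma : R) (u v : 'rV[R]_n) :
  1 < p -> p <= 2 -> 0 < gamma ->
  enorm (dpenalty p gamma u - dpenalty p gamma v)
    <= 4 / gamma * enorm (u - v) `^ (p - 1).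
Proof.
move=> p1 p2 g0.
have pm2 : p - 2 <= 0 by lra.
have tmp : 2 - p <= 1 by lra.
wlog vu : u v / enorm v <= enorm u.
  move=> H; have [/H//|/ltW/H] := leP (enorm v) (enorm u).
  by rewrite !(enormB v) (enormB (dpenalty p gamma v)).
have [v0|vN0] := eqVneq (enorm v) 0.
  rewrite (enorm0_eq0 v0) {2}/dpenalty scaler0 !subr0 enorm_dpenalty//.
  by rewrite mulrC ler_wpM2r ?powR_ge0// ler_pdivlMr// mulVf ?gt_eqF// ler1n.
have v0 : 0 < enorm v by rewrite lt_def vN0 enorm_ge0.
have u0 : 0 < enorm u := lt_le_trans v0 vu.
have [d0|dN0] := eqVneq (enorm (u - v)) 0.
  have /eqP := enorm0_eq0 d0; rewrite subr_eq0 => /eqP ->.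
  by rewrite subrr enorm0 mulr_ge0 ?divr_ge0 ?powR_ge0 ?(ltW g0).
have d0 : 0 < enorm (u - v) by rewrite lt_def dN0 enorm_ge0.
set a := enorm u in vu u0 *; set b := enorm v in vu v0 *.
set d := enorm (u - v) in d0 *.
have mulp (t : R) : 0 < t -> t `^ (p - 2) * t = t `^ (p - 1).
  move=> t0; rewrite -[X in _ * X](powRr1 (ltW t0)) -powRD.
    by congr (_ `^ _); ring.
  by rewrite (gt_eqF t0) implybT.
have abd : a <= d + b.
  by have := enorm_triangle (u - v) v; rewrite subrK.
have d2a : d <= 2 * a.
  by have := enorm_triangle u (- v); rewrite enormN -/a -/b -/d; lra.
have -> : dpenalty p gamma u - dpenalty p gamma v =
   gamma^-1 *: (a `^ (p - 2) *: (u - v) + (- (b `^ (p - 2) - a `^ (p - 2))) *: v).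
  by apply/rowP => i; rewrite !mxE -/a -/b; field; rewrite gt_eqF.
rewrite enormZ ger0_norm ?invr_ge0 ?(ltW g0)//.
rewrite [leRHS](_ : _ = gamma^-1 * (4 * d `^ (p - 1))); last by ring.
rewrite ler_pM2l ?invr_gt0//.
apply: le_trans (enorm_triangle _ _) _.
rewrite !enormZ normrN !ger0_norm ?powR_ge0 ?subr_ge0//; last first.
  exact: le0_ger_powR.
rewrite -/b -/d mulrBl mulp//.
have ba : b `^ (p - 1) <= a `^ (p - 1).
  by apply: ge0_ler_powR; rewrite ?nnegrE; lra.
have A0 := powR_ge0 a (p - 2).
apply: (@le_trans _ _ (2 * a `^ (p - 2) * d)).
  have := mulp a u0 => aE.
  have : a `^ (p - 2) * (a - b) <= a `^ (p - 2) * d by rewrite ler_wpM2l//; lra.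
  by lra.
(* As [p - 2 <= 0], the bound [d / 2 <= a] trades [a] for [d] at the cost of [2^(2-p) <= 2]; with
   the two terms above this gives the constant 4. *)
have : a `^ (p - 2) <= (d / 2) `^ (p - 2).
  by apply: le0_ger_powR; rewrite ?divr_gt0// ler_pdivrMr// mulrC.
rewrite powRM ?invr_ge0 ?(ltW d0)// -(@powR_inv1 _ 2)// -powRrM mulN1r opprB => H.
have P2 : 2 `^ (2 - p) <= 2 :> R.
  by rewrite -[leRHS]powRr1//; apply: ler_powR => //; rewrite ler1n.
have D0 := powR_ge0 d (p - 2).
rewrite -(mulp d d0) mulrA ler_pM2r//.
rewrite (le_trans (ler_wpM2l _ H))// mulrCA.
rewrite [leRHS](_ : _ = d `^ (p - 2) * (2 * 2)); last by ring.
by rewrite !ler_wpM2l.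
Qed.

(** * Existence and localisation of proximal points *)

(** If the infimum [m] were not attained, each point of [K] would have a neighbourhood where
    [f > m + e] for all small [e > 0]. Compactness makes one [e] serve all of [K], contradicting
    that [m] is the infimum. *)
Lemma lower_semicontinuous_attains_min (R : realType) (X : topologicalType)
    (f : X -> \bar R) (K : set X) (c : R) (x0 : X) :
  lower_semicontinuous f -> compact K -> (forall x, K x -> (c%:E <= f x)%E) ->
  K x0 -> (f x0 < +oo)%E ->
  exists2 x, K x & forall y, K y -> (f x <= f y)%E.
Proof.
move=> lscf cK cf Kx0 fx0.
set m := ereal_inf [set f x | x in K].
have mlb x : K x -> (m <= f x)%E by move=> Kx; apply: ereal_inf_lbound; exists x.
have cm : (c%:E <= m)%E by apply: le_ereal_inf_tmp => _ [x Kx <-]; exact: cf.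
have mfin : m \is a fin_num.
  rewrite fin_numE gt_eqF ?(lt_le_trans _ cm) ?ltNyr//= lt_eqF//.
  exact: le_lt_trans (mlb _ Kx0) fx0.
apply: contrapT => noMin.
have ltf x : K x -> (m < f x)%E.
  move=> Kx; rewrite lt_neqAle mlb// andbT; apply/negP => /eqP mfx.
  by apply: noMin; exists x => // y Ky; rewrite -mfx mlb.
move: (fineK mfin) ltf mlb; set m0 := fine m => <- ltf mlb.
pose P e x := (m0%:E + e%:E < f x)%E.
have Pnear x : K x -> \forall x' \near x & e \near (0:R)^'+, P e x'.
  move=> Kx; have [a m0a afx] : exists2 a : R, m0 < a & (a%:E < f x)%E.
    have := ltf x Kx; case: (f x) => [r||//].
      rewrite lte_fin => m0r; exists ((m0 + r) / 2); first by rewrite midf_lt.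
      by rewrite lte_fin midf_lt.
    by move=> _; exists (m0 + 1); rewrite ?ltrDl ?ltry.
  have [V Vx Vf] := lscf x a afx.
  exists (V, [set e | e < a - m0]) => [|[y e] /= [Vy ea]].
    by split => //=; apply: nbhs_right_lt; rewrite subr_gt0.
  by apply: lt_trans (Vf y Vy); rewrite -EFinD lte_fin; lra.
have /compact_near_coveringP/(_ _ _ _ _ Pnear) KP := cK.
have [e [KPe e0]] : exists e : R, K `<=` P e /\ 0 < e.
  apply: (@filter_ex _ (0:R)^'+); near=> e; split; last by near: e; exact: nbhs_right_gt.
  by near: e.
have : ((m0 + e)%:E <= m)%E.
  by apply: le_ereal_inf_tmp => _ [x Kx <-]; exact/ltW/KPe.
by rewrite -(fineK mfin) lee_fin -/m0; lra.
Unshelve. all: by end_near. Qed.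

(** Midpoint convexity of the power: in the sum of the tangent inequalities at [m = (s + t) / 2],
    taken at [s] and at [t], the linear terms cancel. *)
Lemma powR_add_le (R : realType) (p s t : R) : 1 < p -> p <= 2 ->
  0 <= s -> 0 <= t -> (s + t) `^ p <= 2 `^ (p - 1) * (s `^ p + t `^ p).
Proof.
move=> p1 p2 s0 t0; have p0 : 0 < p by lra.
set m := (s + t) / 2.
have m0 : 0 <= m by rewrite /m; lra.
have mr : m <= s + t by rewrite /m; lra.
have tangent b : 0 <= b -> b <= s + t ->
    m `^ p / p + m `^ (p - 1) * (b - m) <= b `^ p / p.
  move=> b0 br; apply: le_trans (powR_strongly_convex p1 p2 m0 mr b0 br).
  rewrite lerDl mulr_ge0 ?sqr_ge0// divr_ge0// mulr_ge0 ?powR_ge0//.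
  by rewrite subr_ge0 ltW.
have Hs : m `^ p / p + m `^ (p - 1) * (s - m) <= s `^ p / p.
  by apply: tangent; lra.
have Ht : m `^ p / p + m `^ (p - 1) * (t - m) <= t `^ p / p.
  by apply: tangent; lra.
have H : (2 * m `^ p) / p <= (s `^ p + t `^ p) / p.
  rewrite [leLHS](_ : _ = m `^ p / p + m `^ (p - 1) * (s - m) +
    (m `^ p / p + m `^ (p - 1) * (t - m))); last by rewrite /m; field; lra.
  by rewrite [leRHS]mulrDl lerD.
rewrite ler_pM2r ?invr_gt0// in H.
have -> : s + t = 2 * m by rewrite /m; field.
rewrite powRM// -[X in X * _](@mulr_powRB1 _ 2 p)// mulrAC mulrC.
by rewrite ler_wpM2l// powR_ge0.
Qed.

Lemma p_calm_lower_bound (R : realType) (n : nat) (phi : 'rV[R]_n -> \bar R)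
    (p M : R) (y : 'rV[R]_n) :
  1 < p -> p_calm phi p M 0 -> phi 0 = 0%E ->
  ((- (M * enorm y `^ p))%:E <= phi y)%E.
Proof.
move=> p1 calm phi0; have [->|yN0] := eqVneq y 0.
  by rewrite phi0 enorm0 powR0 ?mulr0 ?oppr0// gt_eqF// (lt_trans _ p1).
have := calm y yN0; rewrite phi0 subr0; case: (phi y) => [r||//].
  by rewrite -EFinD lte_fin lee_fin => H; lra.
by rewrite leey.
Qed.

Lemma prox_objE (R : realType) (n : nat) (phi : 'rV[R]_n -> \bar R)
    (p gamma : R) (x y : 'rV[R]_n) :
  prox_obj phi p gamma x y = (phi y + (penalty p gamma (x - y))%:E)%E.
Proof. by []. Qed.

(* Calmness bounds [phi y] below by [- M |y|^p], which the penalty absorbs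
   because [|y|^p <= 2^(p-1) (|x|^p + |x - y|^p)]. *)
Lemma prox_obj_localized (R : realType) (n : nat) (phi : 'rV[R]_n -> \bar R)
    (p M gamma : R) :
  1 < p -> p <= 2 -> 0 < M -> 0 < gamma -> p_calm phi p M 0 -> phi 0 = 0%E ->
  M * 2 `^ (p - 1) * (p * gamma) < 1 ->
  exists2 K : R, 0 <= K & forall x y : 'rV[R]_n,
    (prox_obj phi p gamma x y <= prox_obj phi p gamma x 0)%E ->
    enorm (x - y) <= K * enorm x.
Proof.
move=> p1 p2 M0 g0 calm phi0 small; have p0 : 0 < p by lra.
set A := (p * gamma)^-1; set B := M * 2 `^ (p - 1).
have A0 : 0 < A by rewrite invr_gt0 mulr_gt0.
have B0 : 0 <= B by rewrite mulr_ge0 ?powR_ge0 ?(ltW M0).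
have BA : B < A by rewrite -[A]mul1r ltr_pdivlMr ?mulr_gt0.
(* The estimates combine to [(A - B) |x - y|^p <= (A + B) |x|^p]; [K] is the [p]-th root of the
   quotient. *)
exists (((A + B) / (A - B)) `^ p^-1); first exact: powR_ge0.
move=> x y; set d := enorm (x - y); set a := enorm x.
rewrite /prox_obj phi0 add0e subr0 -/d -/a => /(le_trans _) H.
have {H} : - (M * enorm y `^ p) + d `^ p * A <= a `^ p * A.
  rewrite -lee_fin EFinD; apply: H; rewrite leeD2r//.
  exact: p_calm_lower_bound.
have ya : enorm y <= a + d.
  by have := enorm_triangle x (y - x); rewrite subrKC (enormB y).
have a0 : 0 <= a := enorm_ge0 x; have d0 : 0 <= d := enorm_ge0 (x - y).
have ypow : M * enorm y `^ p <= B * (a `^ p + d `^ p).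
  rewrite /B -mulrA ler_pM2l//.
  apply: le_trans (powR_add_le p1 p2 a0 d0).
  by apply: ge0_ler_powR; rewrite ?nnegrE ?enorm_ge0 ?addr_ge0 ?(ltW p0).
move=> H; have {}H : d `^ p <= (A + B) / (A - B) * a `^ p.
  rewrite mulrAC ler_pdivlMr ?subr_gt0//.
  by clearbody A B; clear -H ypow; lra.
have C0 : 0 <= (A + B) / (A - B).
  by rewrite divr_ge0 ?subr_ge0 ?addr_ge0 ?(ltW A0)// ltW.
rewrite leNgt; apply/negP => /(gt0_ltr_powR p0).
rewrite !nnegrE mulr_ge0 ?powR_ge0// => /(_ isT d0).
rewrite powRM ?powR_ge0// -powRrM mulVf ?gt_eqF// powRr1//.
by rewrite ltNge H.
Qed.

(** The tangent inequality bounds the penalty at [x - z] below by its value at [x - y] minus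
    [D |z - y|]. The slack [d] in [phi] absorbs this loss once [|z - y| < d / (D + 1)]; the [+ 1]
    covers [D = 0]. *)
Lemma lower_semicontinuous_prox_obj (R : realType) (n : nat)
    (phi : 'rV[R]_n -> \bar R) (p gamma : R) (x : 'rV[R]_n) :
  1 < p -> p <= 2 -> 0 < gamma -> lower_semicontinuous phi ->
  lower_semicontinuous (prox_obj phi p gamma x).
Proof.
move=> p1 p2 g0 lsc y a; rewrite prox_objE.
set g := penalty p gamma; set gy := g (x - y) => H.
have {}H : ((a - gy)%:E < phi y)%E.
  by move: H; case: (phi y) => [r||]//; rewrite ?ltry// -EFinD !lte_fin ltrBlDr.
have [d d0 Hd] : exists2 d : R, 0 < d & ((a - gy + d)%:E < phi y)%E.
  move: H; case: (phi y) => [r||//].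
    rewrite lte_fin => H; exists ((r - (a - gy)) / 2).
      by rewrite divr_gt0 ?subr_gt0.
    by rewrite lte_fin; lra.
  by move=> _; exists 1; rewrite ?ltry.
have [V Vy HV] := lsc y _ Hd.
set D := enorm (dpenalty p gamma (x - y)).
have D0 : 0 <= D := enorm_ge0 _.
have e0 : 0 < d / (D + 1) by rewrite divr_gt0//; lra.
exists (V `&` [set z | enorm (z - y) < d / (D + 1)]).
  by apply: filterI => //; exact: nbhs_enorm.
move=> z [/HV Hz]; rewrite /= ltr_pdivlMr; last by lra.
move=> zy; rewrite prox_objE -/g.
suff : a - gy + d + g (x - z) > a.
  move: Hz; case: (phi z) => [s||]//; rewrite ?ltry// -EFinD !lte_fin.
  by move=> Hz Ha; apply: lt_trans Ha _; rewrite ltrD2r.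
have := penalty_convex (x - y) (x - z) p1 p2 g0; rewrite -/g -/gy.
have -> : x - z - (x - y) = y - z by rewrite opprB addrC addrA subrK.
have := dotp_ge (dpenalty p gamma (x - y)) (y - z).
rewrite -/D (enormB y); have := enorm_ge0 (z - y); lra.
Qed.

(** Minimise over a compact box around [x] that contains [0] and every point at least as good as
    [0]; points outside are worse than [0], so the minimiser is global. *)
Lemma prox_nonempty (R : realType) (n : nat) (phi : 'rV[R]_n -> \bar R)
    (p M gamma : R) (x : 'rV[R]_n) :
  1 < p -> p <= 2 -> 0 < M -> 0 < gamma -> lower_semicontinuous phi ->
  p_calm phi p M 0 -> phi 0 = 0%E -> M * 2 `^ (p - 1) * (p * gamma) < 1 ->
  exists y, prox phi p gamma x y.
Proof.
move=> p1 p2 M0 g0 lsc calm phi0 small.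
have [K K0 HK] := prox_obj_localized p1 p2 M0 g0 calm phi0 small.
(* [K |x|] captures the competitors of [0], and the extra [|x|] captures [0] itself. *)
pose r := (K + 1) * enorm x.
pose C := [set y : 'rV[R]_n | forall i,
  `[x ord0 i - r, x ord0 i + r]%classic (y ord0 i)].
have cC : compact C.
  by apply: (rV_compact (fun i => @segment_compact _ _ _)).
have inC (y : 'rV[R]_n) : enorm (x - y) <= r -> C y.
  move=> xyr i /=; rewrite in_itv /= -ler_distlC.
  by apply: le_trans xyr; have := coord_le_enorm (x - y) i; rewrite !mxE distrC.
have xr : enorm x <= r.
  by rewrite /r mulrDl mul1r lerDr mulr_ge0 ?enorm_ge0.
have C0 : C 0 by apply: inC; rewrite subr0.
have Clb y : C y ->
    ((- (M * (enorm x + n.+1%:R * r) `^ p))%:E <= prox_obj phi p gamma x y)%E.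
  move=> Cy; rewrite /prox_obj -[leLHS]adde0 leeD//; last first.
    by rewrite lee_fin; apply: penalty_ge0 => //; lra.
  apply: le_trans (p_calm_lower_bound y p1 calm phi0).
  rewrite lee_fin lerN2 ler_pM2l//; apply: ge0_ler_powR.
  - by lra.
  - by rewrite nnegrE enorm_ge0.
  - by rewrite nnegrE addr_ge0 ?mulr_ge0 ?enorm_ge0 ?addr_ge0.
  rewrite -[y in enorm y](subrKC x) (le_trans (enorm_triangle _ _))// lerD2l.
  apply: le_trans (enorm_le_norm _) _; rewrite ler_pM2l ?ltr0n//.
  rewrite [leLHS]/Num.norm /= mx_normrE; apply/bigmax_leP; split.
    by rewrite mulr_ge0 ?addr_ge0 ?enorm_ge0.
  move=> [i j] _ /=; rewrite ord1 !mxE distrC ler_distlC.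
  by have := Cy j; rewrite /= in_itv.
have fin0 : (prox_obj phi p gamma x 0 < +oo)%E.
  by rewrite /prox_obj phi0 add0e ltry.
have lscF : lower_semicontinuous (prox_obj phi p gamma x).
  exact: lower_semicontinuous_prox_obj.
have [y Cy ymin] := lower_semicontinuous_attains_min lscF cC Clb C0 fin0.
exists y; rewrite /prox /= => z.
case/orP: (le_total (prox_obj phi p gamma x z) (prox_obj phi p gamma x 0)) => zle.
  2: exact: le_trans (ymin _ C0) zle.
apply: ymin; apply: inC; apply: le_trans (HK _ _ zle) _.
by rewrite /r ler_wpM2r ?enorm_ge0// lerDl.
Qed.

(** * Local behaviour of proximal points *)

Lemma prox_fin_num (R : realType) (n : nat) (phi : 'rV[R]_n -> \bar R)
    (p M gamma : R) (x y : 'rV[R]_n) :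
  1 < p -> p_calm phi p M 0 -> phi 0 = 0%E ->
  prox phi p gamma x y -> phi y \is a fin_num.
Proof.
move=> p1 calm phi0 /(_ 0); rewrite !prox_objE phi0 add0e.
have := p_calm_lower_bound y p1 calm phi0.
by case: (phi y).
Qed.

Lemma prox_obj_fin (R : realType) (n : nat) (phi : 'rV[R]_n -> \bar R)
    (p gamma : R) (x y : 'rV[R]_n) : phi y \is a fin_num ->
  prox_obj phi p gamma x y = (fine (phi y) + penalty p gamma (x - y))%:E.
Proof. by move=> fy; rewrite prox_objE -{1}(fineK fy) EFinD. Qed.

Lemma prox_le_fin (R : realType) (n : nat) (phi : 'rV[R]_n -> \bar R)
    (p gamma : R) (x y z : 'rV[R]_n) : prox phi p gamma x y ->
  phi y \is a fin_num -> phi z \is a fin_num ->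
  fine (phi y) + penalty p gamma (x - y) <= fine (phi z) + penalty p gamma (x - z).
Proof.
move=> xy fy fz; have := xy z.
by rewrite (prox_obj_fin _ _ _ fy) (prox_obj_fin _ _ _ fz) lee_fin.
Qed.

(** By minimality [phi z - phi y] is at least the penalty at [x - y] minus that at [x - z]. The
    tangent at [x - z] bounds this below by [<J (x - z), z - y>], and [J (x - z)] is [e]-close to
    [J (x - y)] by the Hölder estimate. *)
Lemma prox_frechet_subdiff (R : realType) (n : nat) (phi : 'rV[R]_n -> \bar R)
    (p gamma : R) (x y : 'rV[R]_n) :
  1 < p -> p <= 2 -> 0 < gamma -> phi y \is a fin_num ->
  prox phi p gamma x y -> frechet_subdiff phi y (dpenalty p gamma (x - y)).
Proof.
move=> p1 p2 g0 fy xy; split=> // e e0.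
have pm1 : 0 < p - 1 by rewrite subr_gt0.
have [|d d0 Hd] := @powR_small _ (p - 1) (e * gamma / 4) pm1.
  by rewrite divr_gt0// mulr_gt0.
exists d => // z zyd; set zeta := dpenalty p gamma (x - y).
have := xy z; rewrite !prox_objE -(fineK fy).
case: (phi z) => [s|_|]; rewrite ?leey//.
rewrite -!EFinD !lee_fin => H.
have := penalty_convex (x - z) (x - y) p1 p2 g0.
have -> : x - y - (x - z) = z - y by rewrite opprB addrC addrA subrK.
have -> : dpenalty p gamma (x - z) = (dpenalty p gamma (x - z) - zeta) + zeta.
  by rewrite subrK.
rewrite dotpDl => Hc.
have Hh : enorm (dpenalty p gamma (x - z) - zeta) <= e.
  apply: le_trans (dpenalty_hoelder _ _ p1 p2 g0) _.
  have -> : x - z - (x - y) = y - z by rewrite opprB addrC addrA subrK.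
  rewrite enormB mulrAC ler_pdivrMr// mulrC -ler_pdivlMr//.
  by apply: Hd; [exact: enorm_ge0|exact: ltW].
have := dotp_ge (dpenalty p gamma (x - z) - zeta) (z - y).
have := ler_wpM2r (enorm_ge0 (z - y)) Hh.
move: (enorm (_ - zeta)) (dotp (_ - zeta) _) (dotp zeta _) (enorm (z - y)) H Hc.
by move: (penalty _ _ (x - y)) (penalty _ _ (x - z)) (fine _); clear; move=> *; lra.
Qed.

Lemma frechet_subdiff_limiting (R : realType) (n : nat)
    (phi : 'rV[R]_n -> \bar R) (x v : 'rV[R]_n) :
  frechet_subdiff phi x v -> limiting_subdiff phi x v.
Proof.
move=> xv; split; first by case: xv.
by exists (fun=> x), (fun=> v); split=> //; exact: cvg_cst.
Qed.

(** Prox-regularity at [y] with subgradient [J (x - y)] and strong convexity of the penalty are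
    added; their linear terms cancel. The bound [r^(p-1) / gamma <= eps] makes the subgradient
    admissible, and [|z - y| <= 1] with [q >= 2] replaces the [q]-th power by the square. *)
Lemma prox_quadratic_growth (R : realType) (n : nat)
    (phi : 'rV[R]_n -> \bar R) (p q eps rho gamma r : R) (x y z : 'rV[R]_n) :
  1 < p -> p <= 2 -> 0 < gamma -> phi 0 = 0%E -> 2 <= q -> 0 < rho ->
  q_prox_regular phi q 0 0 eps rho ->
  phi y \is a fin_num -> prox phi p gamma x y -> (phi y < eps%:E)%E ->
  enorm y <= eps -> enorm z <= eps -> enorm (z - y) <= 1 ->
  enorm (x - y) <= r -> enorm (x - z) <= r -> r `^ (p - 1) / gamma <= eps ->
  (prox_obj phi p gamma x y +
     (((p - 1) * r `^ (p - 2) / gamma - rho) / 2 * enorm (z - y) ^+ 2)%:E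
   <= prox_obj phi p gamma x z)%E.
Proof.
move=> p1 p2 g0 phi0 q2 rho0 [_ reg] fy xy yeps ny nz zy1 uyr uzr reps.
set k := (p - 1) * r `^ (p - 2) / gamma.
have := reg y (dpenalty p gamma (x - y)); rewrite /eball /= !subr0 phi0 add0e.
have /frechet_subdiff_limiting lim_y := prox_frechet_subdiff p1 p2 g0 fy xy.
have r0 : 0 <= r := le_trans (enorm_ge0 _) uyr.
have zetaeps : enorm (dpenalty p gamma (x - y)) <= eps.
  apply: le_trans reps; rewrite enorm_dpenalty// ler_pM2r ?invr_gt0//.
  by apply: ge0_ler_powR; rewrite ?nnegrE ?enorm_ge0// subr_ge0 ltW.
move=> /(_ ny lim_y zetaeps yeps z); rewrite subr0 => /(_ nz).
rewrite !prox_objE -(fineK fy).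
case: (phi z) => [s|_|]; rewrite ?leey//.
rewrite -!EFinD !lee_fin => H.
have := penalty_strongly_convex p1 p2 g0 uyr uzr; rewrite -/k.
have -> : x - z - (x - y) = - (z - y) by rewrite !opprB addrC addrA subrK.
rewrite dotpNr enormN => Hs.
have Hq : enorm (z - y) `^ q <= enorm (z - y) ^+ 2.
  have [->|zyN0] := eqVneq (enorm (z - y)) 0.
    by rewrite powR0 ?expr0n//= gt_eqF// (lt_le_trans _ q2).
  rewrite -powR_mulrn ?enorm_ge0//; apply: ger_powR => //.
  by rewrite zy1 lt_def zyN0 enorm_ge0.
have := ler_wpM2l (ltW rho0) Hq.
move: (enorm (z - y) `^ q) (enorm (z - y) ^+ 2) (dotp _ _) H Hs.
move: (penalty _ _ (x - y)) (penalty _ _ (x - z)) (fine _) k; clear.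
by move=> *; lra.
Qed.

(* The last condition makes the strong convexity of the penalty on a ball of
   radius [r] beat the weak convexity of prox-regularity: for [p < 2] its
   modulus blows up as [r] tends to [0], for [p = 2] it is [1 / gamma]. *)
Lemma prox_radius (R : realType) (p eps rho gamma : R) :
  1 < p -> p <= 2 -> 0 < eps -> 0 < rho -> 0 < gamma ->
  (p = 2 -> gamma < 1 / rho) ->
  exists2 r : R, 0 < r &
    [/\ r <= eps, r + r <= 1, r `^ (p - 1) / gamma <= eps,
        r `^ p / (p * gamma) < eps & rho < (p - 1) * r `^ (p - 2) / gamma].
Proof.
move=> p1 p2 e0 rho0 g0 gp2.
have pm1 : 0 < p - 1 by rewrite subr_gt0.
have p0 : 0 < p by rewrite (lt_trans _ p1).
have eg0 : 0 < eps * gamma by rewrite mulr_gt0.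
have epg0 : 0 < eps * (p * gamma) / 2 by rewrite divr_gt0 ?mulr_gt0.
have [d1 d10 Hd1] := powR_small pm1 eg0.
have [d2 d20 Hd2] := powR_small p0 epg0.
have [d3 d30 Hd3] : exists2 d3 : R, 0 < d3 & forall t, 0 < t -> t <= d3 ->
    rho < (p - 1) * t `^ (p - 2) / gamma.
  move: p2; rewrite le_eqVlt => /predU1P[pE|p2].
    exists 1 => // t _ _; rewrite pE subrr powRr0 mulr1.
    rewrite ltr_pdivlMr// mulrC -ltr_pdivlMr//.
    by have := gp2 pE; rewrite div1r; lra.
  have pm2 : 0 < 2 - p by rewrite subr_gt0.
  (* For [p < 2] the claim reads [t^(2-p) < (p - 1) / (gamma rho)]; halving makes it strict. *)
  have [|d3 d30 Hd3] := @powR_small _ (2 - p) ((p - 1) / (gamma * rho) / 2) pm2.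
    by rewrite !divr_gt0// mulr_gt0.
  exists d3 => // t t0 td; have T0 : 0 < t `^ (2 - p) by rewrite powR_gt0.
  have -> : p - 2 = - (2 - p) by ring.
  have := Hd3 t (ltW t0) td; rewrite powRN.
  rewrite ler_pdivlMr// ler_pdivlMr ?mulr_gt0// => H.
  rewrite ltr_pdivlMr// ltr_pdivlMr//.
  have : 0 < rho * gamma * t `^ (2 - p) by rewrite !mulr_gt0.
  by lra.
pose r := Num.min (Num.min eps (2^-1)) (Num.min d1 (Num.min d2 d3)).
have r0 : 0 < r by rewrite !lt_min e0 invr_gt0 ltr0n d10 d20 d30.
have : r <= r by []; rewrite {2}/r !le_min => /andP[/andP[r1 r2] /and3P[r3 r4 r5]].
exists r => //; split => //.
- by lra.
- by rewrite ler_pdivrMr//; exact/Hd1/r3/ltW.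
- rewrite ltr_pdivrMr ?mulr_gt0//.
  apply: le_lt_trans (Hd2 r (ltW r0) r4) _.
  by rewrite gtr_pMr ?mulr_gt0// invf_lt1// ltr1n.
- exact: Hd3.
Qed.

Lemma penalty_sub_le (R : realType) (n : nat) (p gamma : R) (u v : 'rV[R]_n) :
  1 < p -> p <= 2 -> 0 < gamma ->
  penalty p gamma u - penalty p gamma v
    <= enorm u `^ (p - 1) / gamma * enorm (v - u).
Proof.
move=> p1 p2 g0; have := penalty_convex u v p1 p2 g0.
have := dotp_ge (dpenalty p gamma u) (v - u).
rewrite enorm_dpenalty//; move: (dotp _ _) (_ / gamma) (enorm (v - u)).
by move: (penalty _ _ u) (penalty _ _ v); clear; move=> *; lra.
Qed.

(* Quadratic growth at [y], evaluated at [y'], plus optimality of [y'] for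
   [x'] leaves only differences of penalties at points moved by [x' - x]. *)
Lemma prox_local_hoelder (R : realType) (n : nat)
    (phi : 'rV[R]_n -> \bar R) (p q M eps rho gamma : R) :
  1 < p -> p <= 2 -> 0 < M -> p_calm phi p M 0 -> phi 0 = 0%E ->
  2 <= q -> 0 < eps -> 0 < rho -> q_prox_regular phi q 0 0 eps rho ->
  0 < gamma -> M * 2 `^ (p - 1) * (p * gamma) < 1 ->
  (p = 2 -> gamma < 1 / rho) ->
  exists2 delta : R, 0 < delta & exists2 C : R, 0 < C &
    forall x x' y y' : 'rV[R]_n, enorm x < delta -> enorm x' < delta ->
      prox phi p gamma x y -> prox phi p gamma x' y' ->
      enorm (y' - y) ^+ 2 <= C * enorm (x' - x).
Proof.
move=> p1 p2 M0 calm phi0 q2 e0 rho0 reg g0 small gp2.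
have p0 : 0 < p by rewrite (lt_trans _ p1).
have [K K0 HK] := prox_obj_localized p1 p2 M0 g0 calm phi0 small.
have [r r0 [reps r2 rpe rpe' rk]] := prox_radius p1 p2 e0 rho0 g0 gp2.
set k := (p - 1) * r `^ (p - 2) / gamma in rk.
have K2 : 0 < K + 2 by rewrite ltr_wpDl.
(* Since [|y| <= (K + 1) |x|], all four differences, including the crossed [x - y'] and [x' - y],
   have norm at most [(K + 2) delta = r]. *)
exists (r / (K + 2)); first by rewrite divr_gt0.
have c0 : 0 < (k - rho) / 2 by rewrite divr_gt0// subr_gt0.
(* The denominator is the growth constant; each [eps] is a Lipschitz constant of the penalty on the
   [r]-ball, used once per centre. *)
exists ((eps + eps) / ((k - rho) / 2)); first by rewrite divr_gt0// addr_gt0.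
move=> x x' y y'; rewrite !ltr_pdivlMr// => xr x'r xy xy'.
have loc (z w : 'rV[R]_n) : enorm z * (K + 2) < r -> prox phi p gamma z w ->
    enorm (z - w) <= K * enorm z /\ enorm w <= (K + 1) * enorm z.
  move=> zr zw; have zwK := HK z w (zw 0); split=> //.
  have := enorm_triangle (w - z) z; rewrite subrK enormB => /le_trans; apply.
  by rewrite mulrDl mul1r lerD2r.
have {loc} [[xyK yK] [x'yK y'K]] := (loc _ _ xr xy, loc _ _ x'r xy').
have [a0 b0] := (enorm_ge0 x, enorm_ge0 x').
have Ka : 0 <= K * enorm x by rewrite mulr_ge0.
have Kb : 0 <= K * enorm x' by rewrite mulr_ge0.
have yr : enorm y <= r by apply: le_trans yK _; lra.
have y'r : enorm y' <= r by apply: le_trans y'K _; lra.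
have y'y1 : enorm (y' - y) <= 1.
  apply: le_trans (enorm_triangle _ _) _; rewrite enormN.
  by apply: le_trans r2; rewrite lerD.
have near_r (z w v : 'rV[R]_n) : enorm z * (K + 2) < r ->
    enorm v * (K + 2) < r -> enorm w <= (K + 1) * enorm v -> enorm (z - w) <= r.
  move=> zr vr wv; apply: le_trans (enorm_triangle _ _) _; rewrite enormN.
  apply: le_trans (lerD (lexx _) wv) _; rewrite -(ler_pM2l K2).
  have K1 : 0 <= K + 1 by rewrite addr_ge0.
  by move: zr vr (ler_wpM2l K1 (ltW vr)); clear; move=> *; lra.
have [xyr x'y'r] := (near_r _ _ _ xr xr yK, near_r _ _ _ x'r x'r y'K).
have [xy'r x'yr] := (near_r _ _ _ xr x'r y'K, near_r _ _ _ x'r xr yK).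
have fy := prox_fin_num p1 calm phi0 xy.
have fy' := prox_fin_num p1 calm phi0 xy'.
(* The penalty is nonnegative, so [phi y] is at most the objective at [y], hence at most that at
   [0], namely [|x|^p / (p gamma)]. *)
have phiy : (phi y < eps%:E)%E.
  have : (phi y <= prox_obj phi p gamma x y)%E.
    by rewrite prox_objE leeDl// lee_fin penalty_ge0.
  move=> /le_lt_trans; apply; apply: le_lt_trans (xy 0) _.
  rewrite prox_objE phi0 add0e subr0 lte_fin; apply: le_lt_trans rpe'.
  rewrite ler_pM2r ?invr_gt0 ?mulr_gt0//.
  apply: ge0_ler_powR; rewrite ?nnegrE ?(ltW p0) ?(ltW r0)//.
  by rewrite -(ler_pM2r K2) (le_trans (ltW xr))// ler_peMr ?(ltW r0)//; lra.
have := prox_quadratic_growth p1 p2 g0 phi0 q2 rho0 reg fy xy phiy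
  (le_trans yr reps) (le_trans y'r reps) y'y1 xyr xy'r rpe.
rewrite (prox_obj_fin _ _ _ fy) (prox_obj_fin _ _ _ fy').
rewrite -EFinD lee_fin -/k => growth.
have opt := prox_le_fin xy' fy' fy.
have lip (u v : 'rV[R]_n) : enorm u <= r ->
    penalty p gamma u - penalty p gamma v <= eps * enorm (v - u).
  move=> ur; apply: le_trans (penalty_sub_le _ _ p1 p2 g0) _.
  rewrite ler_wpM2r ?enorm_ge0//; apply: le_trans rpe.
  rewrite ler_pM2r ?invr_gt0//.
  by apply: ge0_ler_powR; rewrite ?nnegrE ?subr_ge0 ?(ltW p1) ?(ltW r0) ?enorm_ge0.
have := lip _ (x' - y') xy'r; have := lip _ (x - y) x'yr.
have -> : x - y - (x' - y) = - (x' - x) by rewrite !opprB addrA subrK.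
have -> : x' - y' - (x - y') = x' - x by rewrite opprB addrA subrK.
rewrite enormN mulrAC ler_pdivlMr// => l1 l2.
move: ((k - rho) / 2) (penalty p gamma (x - y)) (penalty p gamma (x' - y'))
  (penalty p gamma (x - y')) (penalty p gamma (x' - y)) (fine (phi y))
  (fine (phi y')) (enorm (x' - x)) (enorm (y' - y) ^+ 2) opt growth l1 l2.
by clear; move=> *; lra.
Qed.

(** * First-order expansion of the Moreau envelope *)

Lemma moreau_env_prox (R : realType) (n : nat) (phi : 'rV[R]_n -> \bar R)
    (p gamma : R) (x y : 'rV[R]_n) :
  prox phi p gamma x y -> moreau_env phi p gamma x = prox_obj phi p gamma x y.
Proof.
move=> xy; apply/le_anti/andP; split.
  by apply: ereal_inf_lbound; exists y.
by apply: le_ereal_inf_tmp => _ [z _ <-]; exact: xy.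
Qed.

Lemma fine_moreau_env (R : realType) (n : nat) (phi : 'rV[R]_n -> \bar R)
    (p gamma : R) (x y : 'rV[R]_n) :
  prox phi p gamma x y -> phi y \is a fin_num ->
  fine (moreau_env phi p gamma x) = fine (phi y) + penalty p gamma (x - y).
Proof. by move=> xy fy; rewrite (moreau_env_prox xy) (prox_obj_fin _ _ _ fy). Qed.

(** Testing [y] at [x'] and [y'] at [x] bounds the increment by the slopes [J (x' - y)] and
    [J (x - y')]. Their arguments differ from [x - y] by [x' - x] and [y - y'], so the Hölder
    estimate gives one error term for each. *)
Lemma moreau_env_expansion (R : realType) (n : nat)
    (phi : 'rV[R]_n -> \bar R) (p gamma : R) (x x' y y' : 'rV[R]_n) :
  1 < p -> p <= 2 -> 0 < gamma ->
  prox phi p gamma x y -> prox phi p gamma x' y' ->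
  phi y \is a fin_num -> phi y' \is a fin_num ->
  `|fine (moreau_env phi p gamma x') - fine (moreau_env phi p gamma x)
      - dotp (dpenalty p gamma (x - y)) (x' - x)|
  <= 4 / gamma * (enorm (x' - x) `^ (p - 1) + enorm (y' - y) `^ (p - 1))
     * enorm (x' - x).
Proof.
move=> p1 p2 g0 xy xy' fy fy'; set zeta := dpenalty p gamma (x - y).
have e_x := fine_moreau_env xy fy; have e_x' := fine_moreau_env xy' fy'.
have opt := prox_le_fin xy fy fy'; have opt' := prox_le_fin xy' fy' fy.
set N := enorm (x' - x).
have slope (u : 'rV[R]_n) : dotp (dpenalty p gamma u) (x' - x) =
    dotp zeta (x' - x) + dotp (dpenalty p gamma u - zeta) (x' - x).
  by rewrite -dotpDl (addrC zeta) subrK.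
have N0 : 0 <= N := enorm_ge0 _.
have up : dotp (dpenalty p gamma (x' - y) - zeta) (x' - x) <=
    4 / gamma * N `^ (p - 1) * N.
  apply: le_trans (dotp_le _ _) _; rewrite ler_wpM2r//.
  apply: le_trans (dpenalty_hoelder _ _ p1 p2 g0) _.
  by rewrite opprB addrA subrK.
have low : - (4 / gamma * enorm (y' - y) `^ (p - 1) * N) <=
    dotp (dpenalty p gamma (x - y') - zeta) (x' - x).
  apply: le_trans (dotp_ge _ _); rewrite lerN2 ler_wpM2r//.
  apply: le_trans (dpenalty_hoelder _ _ p1 p2 g0) _.
  by rewrite opprB addrC addrA subrK enormB.
have := penalty_convex (x' - y) (x - y) p1 p2 g0.
have -> : x - y - (x' - y) = - (x' - x) by rewrite !opprB addrA subrK.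
rewrite dotpNr slope => cup.
have := penalty_convex (x - y') (x' - y') p1 p2 g0.
have -> : x' - y' - (x - y') = x' - x by rewrite opprB addrA subrK.
rewrite slope => clow.
have P1 : 0 <= 4 / gamma * N `^ (p - 1) * N.
  by rewrite !mulr_ge0 ?powR_ge0 ?invr_ge0 ?(ltW g0).
have P2 : 0 <= 4 / gamma * enorm (y' - y) `^ (p - 1) * N.
  by rewrite !mulr_ge0 ?powR_ge0 ?invr_ge0 ?(ltW g0).
(* Here [g1], [g2], [g3], [g4] are the penalties at [x' - y], [x - y], [x - y'], [x' - y'], [z] is
   the linear term, and [s], [t] are the slope errors. *)
have squeeze (a b z s t f f' g1 g2 g3 g4 e e' : R) :
    e = f + g2 -> e' = f' + g4 -> 0 <= a -> 0 <= b ->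
    s <= a -> - b <= t -> g1 - (z + s) <= g2 -> g3 + (z + t) <= g4 ->
    f + g2 <= f' + g3 -> f' + g4 <= f + g1 ->
    `|e' - e - z| <= a + b.
  by clear; move=> -> -> *; rewrite ler_norml; apply/andP; split; lra.
rewrite mulrDr mulrDl.
exact: squeeze e_x e_x' P1 P2 up low cup clow opt opt'.
Qed.

(** * Topological consequences *)

Lemma continuous_enorm (R : realType) (n : nat) (f : 'rV[R]_n -> 'rV[R]_n)
    (x : 'rV[R]_n) :
  (forall e : R, 0 < e -> exists2 d : R, 0 < d &
    forall z, enorm (z - x) < d -> enorm (f z - f x) < e) ->
  {for x, continuous f}.
Proof.
move=> H; apply/(@cvgrPdist_lt _ _ _ (nbhs x) (nbhs_filter x)) => e e0.
have [d d0 Hd] := H e e0.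
apply: (@filterS _ (nbhs x) (nbhs_filter x) _ _ _ (nbhs_enorm x d0)) => z /= /Hd.
by rewrite distrC; apply: le_lt_trans; exact: norm_le_enorm.
Qed.

Lemma enorm_open_ball (R : realType) (n : nat) (d : R) :
  open [set x : 'rV[R]_n | enorm x < d].
Proof.
rewrite openE => x /= xd; have e0 : 0 < d - enorm x by rewrite subr_gt0.
apply: (@filterS _ (nbhs x) (nbhs_filter x) _ _ _ (nbhs_enorm x e0)) => y /= yx.
by have := enorm_triangle (y - x) x; rewrite subrK; lra.
Qed.

(** Uniqueness of the first-order expansion identifies ['d f x] with [L]; differentiability is then
    the expansion itself. *)
Lemma diff_littleo (R : realType) (V W : normedModType R) (f : V -> W)
    (L : {linear V -> W}) (x : V) :
  continuous L ->
  (forall e : R, 0 < e ->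
    \forall h \near (0 : V), `|f (h + x) - f x - L h| <= e * `|h|) ->
  differentiable f x /\ 'd f x = L :> (V -> W).
Proof.
move=> cL H; have fL : f \o shift x = cst (f x) + L +o_ 0 id.
  apply/eqaddoP => e e0; apply: filterS (H e e0) => h.
  rewrite -![(_ + _ : _ -> _) _]/(_ + _) -![(- _ : _ -> _) _]/(- _) /= /cst.
  by rewrite opprD addrA.
have dL := diff_unique cL fL.
by split=> //; apply/diff_locallyP; rewrite dL.
Qed.

Lemma differentiable_enorm (R : realType) (n : nat) (f : 'rV[R]_n -> R)
    (g x : 'rV[R]_n) :
  (forall e : R, 0 < e -> exists2 d : R, 0 < d &
    forall z, enorm (z - x) < d ->
      `|f z - f x - dotp g (z - x)| <= e * enorm (z - x)) ->
  differentiable f x /\ forall h, 'd f x h = dotp g h.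
Proof.
move=> H.
have lin_g : linear (dotp g : 'rV[R]_n -> R).
  by move=> a u v; rewrite dotpDr dotpZr.
pose L : {linear 'rV[R]_n -> R} :=
  HB.pack (dotp g : 'rV[R]_n -> R) (GRing.isLinear.Build _ _ _ _ _ lin_g).
have cL : continuous L.
  apply: bounded_linear_continuous; apply/linear_boundedP.
  exists (enorm g * n.+1%:R); split; first exact: num_real.
  move=> r gr v; apply: (@le_trans _ _ (enorm g * enorm v)).
    by rewrite ler_norml dotp_ge dotp_le.
  apply: (@le_trans _ _ (enorm g * n.+1%:R * `|v|)).
    by rewrite -mulrA ler_wpM2l ?enorm_ge0// enorm_le_norm.
  by rewrite ler_wpM2r// ltW.
have [|df ->] := @diff_littleo R 'rV[R]_n R f L x cL; last by [].
move=> e e0; have n0 : 0 < n.+1%:R :> R by rewrite ltr0n.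
(* The divisor absorbs the factor between the Euclidean and sup norms. *)
have [|d d0 Hd] := H (e / n.+1%:R); first by rewrite divr_gt0.
apply: (@filterS _ _ (nbhs_filter (0 : 'rV[R]_n)) _ _ _ (nbhs_enorm 0 d0)).
move=> h /=; rewrite subr0 => hd.
have := Hd (h + x); rewrite addrK => /(_ hd) {}Hd; apply: le_trans Hd _.
by rewrite -mulrA ler_wpM2l ?(ltW e0)// ler_pdivrMl// enorm_le_norm.
Qed.

(** The bound [1 / (4 M)] is the value at [p = 2] of [2^(1-p) / (M p)], so both ranges of [gamma]
    give the same coercivity condition. *)
Lemma calm_gamma_small (R : realType) (p M gamma : R) :
  1 < p -> p <= 2 -> 0 < M ->
  (p < 2 -> gamma < 2 `^ (1 - p) / (M * p)) ->
  (p = 2 -> gamma < 1 / (4 * M)) ->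
  M * 2 `^ (p - 1) * (p * gamma) < 1.
Proof.
move=> p1 p2 M0 glt geq; have p0 : 0 < p by rewrite (lt_trans _ p1).
have T0 : 0 < 2 `^ (p - 1) :> R by rewrite powR_gt0.
suff : gamma < (2 `^ (p - 1))^-1 / (M * p).
  rewrite ltr_pdivlMr ?mulr_gt0// -[ltRHS]mul1r ltr_pdivlMr//.
  by apply: le_lt_trans; rewrite le_eqVlt; apply/orP; left; apply/eqP; ring.
move: p2; rewrite le_eqVlt => /predU1P[pE|/glt]; last first.
  by rewrite -powRN opprB.
apply: lt_le_trans (geq pE) _; rewrite pE.
have -> : 2 - 1 = 1 :> R by ring.
rewrite powRr1// le_eqVlt; apply/orP; left; apply/eqP; field.
by rewrite gt_eqF.
Qed.

(** * Regularity of the proximal map and envelope near the origin *)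

Lemma prox_env_C1_at (R : realType) (n : nat) (phi : 'rV[R]_n -> \bar R)
    (p gamma delta : R) (P : 'rV[R]_n -> 'rV[R]_n) (x : 'rV[R]_n) :
  1 < p -> p <= 2 -> 0 < gamma ->
  (forall z, enorm z < delta -> prox phi p gamma z (P z)) ->
  (forall z, enorm z < delta -> phi (P z) \is a fin_num) ->
  enorm x < delta ->
  (forall e : R, 0 < e -> exists2 d : R, 0 < d &
    forall z, enorm (z - x) < d -> enorm (P z - P x) < e) ->
  (forall e : R, 0 < e -> exists2 d : R, 0 < d &
    forall z, enorm (z - x) < d ->
      enorm (dpenalty p gamma (z - P z) - dpenalty p gamma (x - P x)) < e) /\
  (forall e : R, 0 < e -> exists2 d : R, 0 < d &
    forall z, enorm (z - x) < d ->
      `|fine (moreau_env phi p gamma z) - fine (moreau_env phi p gamma x)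
          - dotp (dpenalty p gamma (x - P x)) (z - x)| <= e * enorm (z - x)).
Proof.
move=> p1 p2 g0 Pprox Pfin xd Pcont.
have pm1 : 0 < p - 1 by rewrite subr_gt0.
(* Against the factor [4 / gamma], one term of this size gives [e / 2], hence a strict bound for the
   gradient, and two give exactly [e] for the expansion. *)
split=> e e0; have eg : 0 < e * gamma / 8 by rewrite divr_gt0 ?mulr_gt0.
- have [d d0 Hd] := powR_small pm1 eg.
  have d2 : 0 < d / 2 by rewrite divr_gt0.
  have [d' d'0 Hd'] := Pcont _ d2.
  exists (Num.min (d / 2) d'); first by rewrite lt_min d2.
  move=> z; rewrite lt_min => /andP[zd /Hd' Pzd].
  apply: le_lt_trans (dpenalty_hoelder _ _ p1 p2 g0) _.
  have -> : z - P z - (x - P x) = (z - x) - (P z - P x).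
    by rewrite !opprB addrACA [RHS]addrACA (addrC (- P z)).
  rewrite mulrAC ltr_pdivrMr// mulrC -ltr_pdivlMr//.
  apply: (@le_lt_trans _ _ (e * gamma / 8)); last first.
    by rewrite ltr_pM2l ?mulr_gt0// ltf_pV2 ?posrE// ltr_nat.
  apply: Hd; first exact: enorm_ge0.
  apply: le_trans (enorm_triangle _ _) _; rewrite enormN (splitr d).
  by rewrite lerD// ltW.
- have [d d0 Hd] := powR_small pm1 eg.
  have [d' d'0 Hd'] := Pcont _ d0.
  exists (Num.min (Num.min d d') (delta - enorm x)).
    by rewrite !lt_min d0 d'0 subr_gt0.
  move=> z; rewrite !lt_min => /andP[/andP[zd /Hd' Pzd] zx].
  have zdelta : enorm z < delta.
    have := enorm_triangle (z - x) x; rewrite subrK => /le_lt_trans; apply.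
    by rewrite -ltrBrDr.
  have := moreau_env_expansion p1 p2 g0 (Pprox _ xd) (Pprox _ zdelta)
    (Pfin _ xd) (Pfin _ zdelta).
  move=> /le_trans; apply; rewrite ler_wpM2r ?enorm_ge0//.
  have := lerD (Hd _ (enorm_ge0 _) (ltW zd)) (Hd _ (enorm_ge0 _) (ltW Pzd)).
  move=> H; rewrite mulrAC ler_pdivrMr//.
  move: H; move: (_ `^ _ + _ `^ _); clear; move=> t; lra.
Qed.

Theorem theorem5 (R : realType) (n : nat) (phi : 'rV[R]_n -> \bar R)
    (p q M eps rho gamma : R) :
  1 < p -> p <= 2 ->
  proper_fun phi -> lower_semicontinuous phi ->
  0 < M -> p_calm phi p M 0 -> phi 0 = 0%E ->
  2 <= q -> 0 < eps -> 0 < rho -> q_prox_regular phi q 0 0 eps rho ->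
  0 < gamma ->
  (p < 2 -> gamma < 2 `^ (1 - p) / (M * p)) ->
  (p = 2 -> gamma < Num.min (1 / (4 * M)) (1 / rho)) ->
  exists U : set 'rV[R]_n, [/\ open U, U 0 &
    (exists P : 'rV[R]_n -> 'rV[R]_n,
       (forall x, U x -> prox phi p gamma x = [set P x]) /\
       {within U, continuous P}) /\
    ((forall x, U x -> moreau_env phi p gamma x \is a fin_num) /\
     exists G : 'rV[R]_n -> 'rV[R]_n, {within U, continuous G} /\
       forall x, U x ->
         differentiable (fun y => fine (moreau_env phi p gamma y)) x /\
         forall h, 'd (fun y => fine (moreau_env phi p gamma y)) x h
                   = dotp (G x) h)].
Proof.
move=> p1 p2 _ lsc M0 calm phi0 q2 e0 rho0 reg g0 glt geq.
have small : M * 2 `^ (p - 1) * (p * gamma) < 1.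
  apply: calm_gamma_small => // pE.
  by have := geq pE; rewrite lt_min => /andP[].
have grho : p = 2 -> gamma < 1 / rho.
  by move=> pE; have := geq pE; rewrite lt_min => /andP[].
have [delta delta0 [C C0 HC]] :=
  prox_local_hoelder p1 p2 M0 calm phi0 q2 e0 rho0 reg g0 small grho.
(* Minimisers exist for every centre, so the selection is global; only uniqueness is local. *)
have [P Pprox] : {P : 'rV[R]_n -> 'rV[R]_n &
    forall x, prox phi p gamma x (P x)}.
  by apply: boolp.choice => x; exact: prox_nonempty p1 p2 M0 g0 lsc calm phi0 small.
have Pfin z : phi (P z) \is a fin_num by exact: prox_fin_num p1 calm phi0 (Pprox z).
pose U := [set x : 'rV[R]_n | enorm x < delta].
have oU : open U by exact: enorm_open_ball.
have Pcont x : U x -> forall e : R, 0 < e -> exists2 d : R, 0 < d &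
    forall z, enorm (z - x) < d -> enorm (P z - P x) < e.
  move=> Ux e e_gt0.
  (* The first bound inverts [|P z - P x|^2 <= C |z - x|]; the second keeps [z] in [U]. *)
  exists (Num.min (e ^+ 2 / C) (delta - enorm x)).
    by rewrite lt_min divr_gt0 ?exprn_gt0//= subr_gt0.
  move=> z; rewrite lt_min => /andP[zx zd].
  have Uz : enorm z < delta.
    have := enorm_triangle (z - x) x; rewrite subrK => /le_lt_trans; apply.
    by rewrite -ltrBrDr.
  rewrite -(@ltr_pXn2r _ 2) ?nnegrE ?enorm_ge0 ?(ltW e_gt0)//.
  apply: le_lt_trans (HC _ _ _ _ Ux Uz (Pprox x) (Pprox z)) _.
  by rewrite mulrC -ltr_pdivlMr.
have C1 x (Ux : U x) := prox_env_C1_at p1 p2 g0 (fun z _ => Pprox z)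
  (fun z _ => Pfin z) Ux (Pcont x Ux).
exists U; split; first exact: oU.
  by rewrite /U /= enorm0.
split; first (exists P; split).
- move=> x Ux; apply/seteqP; split => [y xy|_ ->//].
  (* Uniqueness is the Hölder estimate for two minimisers with the same centre. *)
  have := HC _ _ _ _ Ux Ux (Pprox x) xy; rewrite subrr enorm0 mulr0 => H.
  have /eqP : enorm (y - P x) ^+ 2 == 0 by rewrite eq_le H sqr_ge0.
  by move/eqP; rewrite expf_eq0 /= => /eqP/enorm0_eq0/subr0_eq.
- rewrite continuous_open_subspace//= => x; rewrite inE => Ux.
  exact/continuous_enorm/Pcont.
split.
  move=> x Ux; rewrite (moreau_env_prox (Pprox x)) prox_objE.
  by rewrite -(fineK (Pfin x)).
exists (fun x => dpenalty p gamma (x - P x)); split.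
  rewrite continuous_open_subspace//= => x; rewrite inE => Ux.
  by apply: continuous_enorm; case: (C1 x Ux).
by move=> x Ux; apply: differentiable_enorm; case: (C1 x Ux).
Qed.
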